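(* Let $m\ge2$, let $p_1,\dots,p_m>0$ with $\sum_i p_i=1$ be linearly independent over $\mathbb{Q}$, and let $\gamma\in\mathbb{R}$. For the $\gamma$-quota method, with $N$ uniformly distributed on $\{1,\dots,N_0\}$, as $N_0\to\infty$, for every $i$, $$\mathbb{E}\,\Delta_i\to\gamma\Bigl(p_i-\frac1m\Bigr).$$
   Context: There are $m$ parties; party $i$ has proportion $p_i>0$ of the votes. $N$ (the house size) seats are distributed, party $i$ gets $s_i=s_i(N)$ seats with $\sum_i s_i=N$, and the seat excess is $\Delta_i=s_i-Np_i$. For real $\alpha,x$, the $\alpha$-rounding $[x]_\alpha$ is an integer $n$ with $x-\alpha\le n\le x-\alpha+1$ (if $x-\alpha\in\mathbb{Z}$, both $x-\alpha$ and $x-\alpha+1$ are accepted values). The $\gamma$-quota method (for $N+\gamma>0$): $s_i=[(N+\gamma)p_i]_\alpha$ for all $i$, where the real number $\alpha$ (and the choices of rounding in case of ties) are such that $\sum_i s_i=N$. Ties are resolved at random. Finitely many $N$ with $N+\gamma\le0$ are irrelevant for the limit and may be ignored. *)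

(* Defs.v *)
From HB Require Import structures.
From mathcomp Require Import all_boot all_order all_algebra.
From mathcomp Require Import all_classical all_reals all_analysis.
Set Implicit Arguments.
Unset Strict Implicit.
Unset Printing Implicit Defensive.
Import Order.TTheory GRing.Theory Num.Theory.
Local Open Scope classical_set_scope.
Local Open Scope ring_scope.

Definition rat_independent (R : realType) (m : nat) (p : 'I_m -> R) : Prop :=
  forall c : 'I_m -> rat, \sum_i ratr (c i) * p i = 0 -> forall i, c i = 0.

(* A relation rather than a function: if [x - alpha] is an integer, both
   [x - alpha] and [x - alpha + 1] are accepted. *)
Definition is_rounding (R : realType) (alpha x : R) (n : int) : Prop :=
  x - alpha <= n%:~R <= x - alpha + 1.

(* [s] is one of the seat distributions that the gamma-quota method may return
   for house size [N]; several of them exist only in case of a tie.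
   Seats are integers and not naturals, since the rounding formula yields
   negative values for some small [N]. *)
Definition quota_outcome (R : realType) (m : nat) (p : 'I_m -> R) (gamma : R)
    (N : nat) (s : 'I_m -> int) : Prop :=
  \sum_i s i = N%:Z /\
  exists alpha : R, forall i, is_rounding alpha ((N%:R + gamma) * p i) (s i).

(* [S N i w] is the number of seats of party [i] when the house size is [N];
   the sample point [w] carries the random resolution of ties, on which no law
   is imposed.  Integrability amounts to measurability when [N + gamma > 0],
   where [quota_outcome] leaves finitely many values; for the other [N], on
   which the method is silent, [S N] is an arbitrary integrable vector. *)
Definition random_quota_method (R : realType) (m : nat) (p : 'I_m -> R)
    (gamma : R) (d : measure_display) (T : measurableType d)
    (P : probability T R) (S : nat -> 'I_m -> T -> int) : Prop :=
  (forall N i, P.-integrable setT (fun w => ((S N i w)%:~R : R)%:E)) /\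
  (forall N w, (0 < N)%N -> 0 < N%:R + gamma ->
     quota_outcome p gamma N (fun i => S N i w)).

Definition uniform_upto (R : realType) (d : measure_display)
    (T : measurableType d) (P : probability T R) (N0 : nat)
    (X : {RV P >-> nat}) : Prop :=
  forall k : nat, (0 < k <= N0)%N -> P (X @^-1` [set k]) = (N0%:R^-1)%:E.

Definition seat_excess (R : realType) (m : nat) (p : 'I_m -> R) (N : nat)
    (s : 'I_m -> int) (i : 'I_m) : R :=
  (s i)%:~R - N%:R * p i.

(* Main.v *)
(** Let [e_i = s_i - (N + gamma) p_i], so that [sum_i e_i = - gamma].  Rounding
    with a common threshold makes [s] a closest integer point to
    [(N + gamma) p] among those of coordinate sum [N], however ties are
    resolved.  If [h = K p - n] with [n] integral of sum [K], then [s(N) + n]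
    competes with [s(N + K)], whence
      [|e(N + K)|^2 <= |e(N) - h|^2 = |e(N)|^2 - 2 e(N).h + |h|^2].
    Averaging over [N] telescopes the squared norms, so the limiting mean [A]
    of [e] satisfies [A.h <= |h|^2 / 2].  The vectors [h] are dense in the
    hyperplane of sum zero by Kronecker's theorem; taking [h] of size [t] along
    [e_i - e_j] gives [A_i - A_j = O(t)].  Hence all the [A_i] are equal to
    [- gamma / m].

    Density comes from simultaneous approximation: the integer points close to
    the line [R p] span [Q^m], since a rational functional vanishing on all of
    them would vanish at [p]; projecting along [p] a basis of such points gives
    short vectors that span the hyperplane, and rounding real coordinates in
    this basis to integers costs little. *)
Require Import Defs.
From HB Require Import structures.
From mathcomp Require Import all_boot all_order all_algebra.
From mathcomp Require Import all_classical all_reals all_analysis.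
From mathcomp Require Import measurable_realfun ring lra.
Import Order.TTheory GRing.Theory Num.Theory.
Import numFieldNormedType.Exports.
Local Open Scope classical_set_scope.
Local Open Scope ring_scope.
Set Implicit Arguments.
Unset Strict Implicit.
Unset Printing Implicit Defensive.

(** * Density of the multiples of [p] modulo the integer lattice *)

(** Dirichlet's pigeonhole argument: the fractional parts of [#|F|.+1] multiples of [p] fall into
    the [#|F|] boxes of side [1 / Q.+1] of the unit cube, and the difference of two multiples in one
    box is almost integral. Using only multiples of [B.+1] forces [K] to exceed [B]. *)
Lemma simultaneous_approximation (R : realType) (m : nat) (p : 'I_m -> R)
    (eps : R) (B : nat) :
  0 < eps -> exists K (n : 'I_m -> int),
    (B < K)%N /\ forall i, `|K%:R * p i - (n i)%:~R| < eps.
Proof.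
move=> e0.
pose Q := Num.truncn eps^-1.
pose fr (x : R) := x - (Num.floor x)%:~R.
have fr0 x : 0 <= fr x by rewrite subr_ge0 Num.Theory.floor_le.
have fr1 x : fr x < 1.
  by rewrite ltrBlDl; have := floorD1_gt x; rewrite intrD.
have QE : Q.+1%:R^-1 < eps.
  by rewrite invf_plt ?posrE ?ltr0Sn// truncnS_gt.
pose bx (j : nat) : {ffun 'I_m -> 'I_Q.+1} :=
  [ffun i => inord (Num.truncn (Q.+1%:R * fr ((j * B.+1)%:R * p i)))].
pose F := {ffun 'I_m -> 'I_Q.+1}.
have [j [k [jk bjk]]] : exists j k : 'I_#|F|.+1, (j < k)%N /\ bx j = bx k.
  apply: contrapT => H.
  have inj : injective (fun j : 'I_#|F|.+1 => bx j : F).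
    move=> j k bjk; apply/val_inj/eqP; rewrite eqn_leq.
    apply/andP; split; rewrite leqNgt; apply/negP => lt; apply: H.
      by exists k, j.
    by exists j, k.
  by have := leq_card _ inj; rewrite card_ord ltnn.
exists ((k - j) * B.+1)%N,
  (fun i => Num.floor ((k * B.+1)%:R * p i) - Num.floor ((j * B.+1)%:R * p i)).
split; first by rewrite leq_pmull// subn_gt0.
move=> i; apply: lt_trans QE.
have := congr1 (fun f : F => val (f i)) bjk; rewrite !ffunE.
set x := _ * p i; set y := _ * p i => /=.
have bnd z : (Num.truncn (Q.+1%:R * fr z) < Q.+1)%N.
  rewrite -(ltr_nat R); apply: le_lt_trans (_ : Q.+1%:R * fr z < _).
    by rewrite truncn_le ?mulr_ge0.
  by rewrite -{2}[Q.+1%:R]mulr1 ltr_pM2l ?ltr0Sn.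
rewrite !inordK// => xy.
have -> : ((k - j) * B.+1)%:R * p i = y - x.
  by rewrite mulnBl natrB ?leq_mul2r ?(ltnW jk) ?orbT// mulrBl.
rewrite intrB.
have -> : y - x - ((Num.floor y)%:~R - (Num.floor x)%:~R) = fr y - fr x.
  by rewrite /fr; ring.
have tr z : (Num.truncn (Q.+1%:R * fr z))%:R <= Q.+1%:R * fr z <
            (Num.truncn (Q.+1%:R * fr z))%:R + 1.
  rewrite truncn_le ?mulr_ge0//= -[X in _ + X]/(1%:R) -natrD addn1.
  exact: truncnS_gt.
have := tr x; have := tr y; rewrite xy => /andP[y1 y2] /andP[x1 x2].
rewrite -(ltr_pM2l (ltr0Sn R Q)) divff ?pnatr_eq0//.
rewrite -[X in X * _](ger0_norm (ler0n R Q.+1)) -normrM ltr_norml mulrBr.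
by apply/andP; split; lra.
Qed.

(* [near_line p eps n] means that [n] is within [eps], parallel to the
   hyperplane of vectors of sum zero, of the line spanned by [p]. *)
Definition near_line (R : realType) (m : nat) (p : 'I_m -> R) (eps : R)
    (n : 'I_m -> int) : Prop :=
  forall i, `|(\sum_j n j)%:~R * p i - (n i)%:~R| < eps.

Lemma near_line_far (R : realType) (m : nat) (p : 'I_m -> R)
    (eps : R) (B : nat) :
  \sum_i p i = 1 -> 0 < eps -> exists n : 'I_m -> int,
    near_line p eps n /\ B%:Z < \sum_i n i.
Proof.
move=> p1 e0.
(* With errors below [1 / m.+1], the sum of the [m] errors stays below 1, so the integer
   [\sum_i n i] is exactly [K]. *)
have d0 : 0 < Num.min eps m.+1%:R^-1 by rewrite lt_min e0 invr_gt0 ltr0Sn.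
have [K [n [BK nK]]] := simultaneous_approximation p B d0.
have sn : \sum_i n i = K%:Z.
  apply/eqP; rewrite eq_sym -subr_eq0 -normr_le0 -ltzD1 add0r.
  rewrite -(ltr_int R) intr_norm intrB -[X in X%:~R - _]/(K%:Z).
  rewrite (_ : (K%:Z)%:~R - _ = \sum_i (K%:R * p i - (n i)%:~R)); last first.
    by rewrite sumrB -mulr_sumr p1 mulr1 rmorph_sum.
  apply: le_lt_trans (ler_norm_sum _ _ _) _.
  apply: le_lt_trans (_ : \sum_(i < m) m.+1%:R^-1 < _).
    apply: ler_sum => i _; apply/ltW/(lt_le_trans (nK i)).
    by rewrite ge_min lexx orbT.
  rewrite sumr_const card_ord -[X in X < _]mulr_natl.
  rewrite ltr_pdivrMr ?ltr0Sn// mul1r ltr_nat.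
  exact: ltnSn.
exists n; split; last by rewrite sn ltz_nat.
by move=> i; rewrite sn; apply: (lt_le_trans (nK i)); rewrite ge_min lexx.
Qed.

(** By independence the functional [c] takes a nonzero value [s] at [p]. On a near-line vector of
    sum [K] it differs from [K * s] by at most the constant [M], so it cannot vanish once [K]
    exceeds [M / |s|]. *)
Lemma near_line_transverse (R : realType) (m : nat) (p : 'I_m -> R)
    (eps : R) (c : 'I_m -> rat) :
  \sum_i p i = 1 -> rat_independent p -> (exists i, c i != 0) -> 0 < eps ->
  exists n : 'I_m -> int, near_line p eps n /\ \sum_i (n i)%:~R * c i != 0.
Proof.
move=> p1 pQ [k ck] e0.
have cp : 0 < `|\sum_i ratr (c i) * p i|.
  by rewrite normr_gt0; apply: contra_neq ck => /pQ.
set s := \sum_i _ in cp.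
pose M := (\sum_i `|ratr (c i) : R|) * eps.
have [n [nn Bn]] := near_line_far (Num.truncn (M / `|s|)).+1 p1 e0.
exists n; split=> //; apply/eqP => nc.
have nc' : \sum_i ratr (c i) * (n i)%:~R = 0 :> R.
  transitivity (ratr (\sum_i (n i)%:~R * c i) : R); last by rewrite nc rmorph0.
  rewrite rmorph_sum; apply: eq_bigr => i _.
  by rewrite rmorphM /= ratr_int mulrC.
have : `|(\sum_j n j)%:~R * s| <= M.
  have -> : (\sum_j n j)%:~R * s =
      \sum_i ratr (c i) * ((\sum_j n j)%:~R * p i - (n i)%:~R).
    under [RHS]eq_bigr do rewrite mulrBr.
    rewrite sumrB nc' subr0 /s mulr_sumr.
    by apply: eq_bigr => i _; rewrite mulrCA.
  apply: le_trans (ler_norm_sum _ _ _) _; rewrite /M mulr_suml.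
  apply: ler_sum => i _; rewrite normrM ler_wpM2l//.
  exact/ltW/nn.
rewrite normrM -ler_pdivlMr//; apply/negP; rewrite -ltNge.
have Bn' : 0 <= \sum_j n j by apply: le_trans (ltW Bn).
rewrite -intr_norm (ger0_norm Bn').
apply: lt_trans (_ : (Num.truncn (M / `|s|)).+1%:R < _).
  exact: truncnS_gt.
by rewrite -[X in X < _]/(((Num.truncn (M / `|s|)).+1%:Z)%:~R) ltr_int.
Qed.

(** Induction on the rank: while there are fewer than [m] rows, a nonzero column of the cokernel is
    a rational functional vanishing on all of them, and a near-line vector on which it does not
    vanish can be added. *)
Lemma near_line_row_free (R : realType) (m : nat) (p : 'I_m -> R) (eps : R) :
  \sum_i p i = 1 -> rat_independent p -> 0 < eps ->
  forall r, (r <= m)%N -> exists M : 'M[int]_(r, m),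
    (forall k, near_line p eps (M k)) /\
    row_free (map_mx intr M : 'M[rat]_(r, m)).
Proof.
move=> p1 pQ e0; elim=> [_|r IH rm].
  exists 0; split; first by case.
  by rewrite /row_free -leqn0 rank_leq_row.
have [M [Mn Mf]] := IH (ltnW rm).
set Mq := map_mx _ M in Mf.
have : cokermx Mq != 0.
  rewrite -mxrank_eq0 mxrank_coker (eqP (Mf : \rank _ == _)) -lt0n subn_gt0//.
move=> /matrix0Pn[i [j cij]].
have [|n [nn nc]] :=
  @near_line_transverse _ _ _ _ (fun i => cokermx Mq i j) p1 pQ _ e0.
  by exists i.
set N := col_mx (\row_i n i) M.
have Nn k : near_line p eps (N k).
  case: (split_ordP k) => k' ->.
    by apply: eq_ind nn _ _; apply/funext => l; rewrite /N col_mxEu mxE.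
  by apply: eq_ind (Mn k') _ _; apply/funext => l; rewrite /N col_mxEd.
have Nf : row_free (map_mx intr N : 'M[rat]_(1 + r, m)).
  apply: inj_row_free => v.
  rewrite -[v]hsubmxK map_col_mx mul_row_col -/Mq => v0.
  (* The cokernel kills the old rows; its column [j] is nonzero on the new one, so the new row has
     coefficient zero. *)
  have := congr1 (mulmx^~ (cokermx Mq)) v0.
  rewrite mulmxDl mul0mx -(mulmxA (rsubmx v)) mulmx_coker mulmx0 addr0 => v1.
  have l0 : lsubmx v = 0.
    apply/rowP => k; rewrite ord1 [RHS]mxE.
    have /matrixP/(_ 0 j) := v1; rewrite [lsubmx v]mx11_scalar mul_scalar_mx.
    rewrite -scalemxAl mxE [RHS]mxE => /eqP; rewrite mulf_eq0.
    move=> /orP[/eqP l00|]; first by rewrite mxE eqxx mulr1n.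
    suff -> : (map_mx intr (\row_i n i) *m cokermx Mq) 0 j =
        \sum_i (n i)%:~R * cokermx Mq i j by move/negPf: nc => ->.
    by rewrite mxE; apply: eq_bigr => u _; congr (_ * _); rewrite !mxE.
  move: v0; rewrite l0 mul0mx add0r => /eqP.
  by rewrite mulmx_free_eq0// => /eqP ->; rewrite row_mx0.
by exists N.
Qed.

Lemma simultaneous_density (R : realType) (m : nat) (p v : 'I_m -> R)
    (eps : R) :
  \sum_i p i = 1 -> rat_independent p -> \sum_i v i = 0 -> 0 < eps ->
  exists (K : nat) (n : 'I_m -> int), \sum_i n i = K%:Z /\
    forall i, `|K%:R * p i - (n i)%:~R - v i| < eps.
Proof.
move=> p1 pQ v0 e0.
have d0 : 0 < eps / m.+1%:R by rewrite divr_gt0 ?ltr0Sn.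
set d := eps / _ in d0.
have [M [Mn Mf]] := near_line_row_free p1 pQ d0 (leqnn m).
pose MR : 'M[R]_m := map_mx intr M.
have MRu : MR \in unitmx.
  have -> : MR = map_mx ratr (map_mx intr M : 'M[rat]_m).
    by apply/matrixP => i j; rewrite !mxE ratr_int.
  by rewrite map_unitmx -row_free_unit.
(* The minus sign matches [h = K p - n], in which integer vectors are subtracted. *)
pose x := - (\row_i v i) *m invmx MR.
have xM i : \sum_k x 0 k * (M k i)%:~R = - v i.
  have /matrixP/(_ 0 i) : x *m MR = - (\row_i v i) by rewrite mulmxKV.
  by rewrite !mxE => <-; apply: eq_bigr => k _; rewrite !mxE.
pose y k : int := Num.floor (x 0 k).
pose s k : int := \sum_j M k j.
(* Since [v] has sum zero, the real combination [x] of the rows does not move along [p]; only the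
   rounding of [x] does. *)
have xs : \sum_k x 0 k * (s k)%:~R = 0.
  under eq_bigr do rewrite rmorph_sum mulr_sumr.
  rewrite exchange_big /=; under eq_bigr do rewrite xM.
  by rewrite sumrN v0 oppr0.
(* The rounded combination may have a negative sum; a far near-line vector makes the total a natural
   number at the cost of one more error [d]. *)
have [n0 [nn Bn]] := near_line_far (absz (\sum_k y k * s k)) p1 d0.
pose n i := n0 i + \sum_k y k * M k i.
have sn : \sum_i n i = \sum_i n0 i + \sum_k y k * s k.
  rewrite big_split /= exchange_big /=; congr (_ + _).
  by apply: eq_bigr => k _; rewrite mulr_sumr.
have sn0 : 0 <= \sum_i n i.
  rewrite sn -lerBlDr sub0r; apply: le_trans (ltW Bn).
  by rewrite abszE -normrN ler_norm.
exists (absz (\sum_i n i)), n; split; first by rewrite gez0_abs.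
move=> i.
have -> : (absz (\sum_i n i))%:R = (\sum_i n i)%:~R :> R.
  by rewrite -[in RHS](gez0_abs sn0).
have -> : (\sum_i n i)%:~R * p i - (n i)%:~R - v i =
    ((\sum_j n0 j)%:~R * p i - (n0 i)%:~R) +
    \sum_k ((y k)%:~R - x 0 k) * ((s k)%:~R * p i - (M k i)%:~R).
  have -> : \sum_k ((y k)%:~R - x 0 k) * ((s k)%:~R * p i - (M k i)%:~R) =
      (\sum_k (y k * s k)%:~R) * p i - \sum_k (y k * M k i)%:~R
      - ((\sum_k x 0 k * (s k)%:~R) * p i - \sum_k x 0 k * (M k i)%:~R).
    rewrite !mulr_suml -!sumrB; apply: eq_bigr => k _; rewrite !intrM; ring.
  rewrite xs xM sn /n !intrD !rmorph_sum /=; ring.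
(* One [d] pays for [n0], and one for each of the [m] rounded coordinates. *)
have dE : eps = d + \sum_(k < m) d.
  by rewrite sumr_const card_ord -mulrS -mulr_natr divfK// pnatr_eq0.
rewrite [X in _ < X]dE; apply: le_lt_trans (ler_normD _ _) _.
apply: ltr_leD; first exact: nn.
apply: le_trans (ler_norm_sum _ _ _) _; apply: ler_sum => k _.
rewrite normrM -[X in _ <= X]mul1r; apply: ler_pM => //; last exact/ltW/Mn.
rewrite distrC ger0_norm ?subr_ge0 ?floor_le// lerBlDl.
by have := floorD1_gt (x 0 k); rewrite intrD => /ltW.
Qed.

(** * Optimality of the quota method *)

(** A Lagrange multiplier inequality. With [e = s - x] in [[- alpha, 1 - alpha]] and [d = n - s],
    the difference of the two sides is [d * (d - 1) + 2 * d * (e + alpha)], which is nonnegative for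
    every integer [d]. The multiplier depends on [alpha] only, so it cancels between distributions
    of equal total. *)
Lemma rounding_optimal (R : realType) (alpha x : R) (s n : int) :
  is_rounding alpha x s ->
  (1 - 2 * alpha) * (n - s)%:~R <= (n%:~R - x) ^+ 2 - (s%:~R - x) ^+ 2.
Proof.
rewrite /is_rounding => /andP[s1 s2].
have -> : n%:~R - x = s%:~R - x + (n - s)%:~R by rewrite intrB; ring.
move: (n - s) => D; set d : R := D%:~R; set e := s%:~R - x.
have [D1|D1|D0] := ltrgtP D 0.
- have d1 : d <= - 1.
    by rewrite -[- 1]/((- 1)%:~R) ler_int -ltzD1.
  have e1 : e <= 1 - alpha by rewrite /e; lra.
  have n1 : 0 <= (1 - alpha - e) * - d by rewrite mulr_ge0 ?subr_ge0//; lra.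
  have n2 : 0 <= (d + 1) * d by rewrite mulr_le0 //; lra.
  lra.
- have d1 : 1 <= d by rewrite -[1]/(1%:~R) ler_int -gtz0_ge1.
  have e1 : - alpha <= e by rewrite /e; lra.
  have n1 : 0 <= (e + alpha) * d by rewrite mulr_ge0//; lra.
  have n2 : 0 <= (d - 1) * d by rewrite mulr_ge0//; lra.
  lra.
by rewrite /d D0; lra.
Qed.

(** Centred at the number that gets rounded; it is the seat excess minus the constant
    [gamma * p i]. *)
Definition quota_error (R : realType) (m : nat) (p : 'I_m -> R) (gamma : R)
    (N : nat) (s : 'I_m -> int) (i : 'I_m) : R :=
  (s i)%:~R - (N%:R + gamma) * p i.

Section QuotaError.
Variables (R : realType) (m : nat) (p : 'I_m -> R) (gamma : R).
Hypothesis p1 : \sum_i p i = 1.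

Lemma quota_error_sum (N : nat) (s : 'I_m -> int) :
  quota_outcome p gamma N s -> \sum_i quota_error p gamma N s i = - gamma.
Proof.
case=> sN _; rewrite sumrB -mulr_sumr p1 -rmorph_sum /= sN.
rewrite -[N%:Z%:~R]/(N%:R); ring.
Qed.

(** The common threshold puts all errors into one interval of length 1, so each is within 1 of their
    average [- gamma / m]. *)
Lemma quota_error_bound (N : nat) (s : 'I_m -> int) (i : 'I_m) :
  quota_outcome p gamma N s -> `|quota_error p gamma N s i| <= 1 + `|gamma|.
Proof.
move=> qs; have es := quota_error_sum qs; case: qs => _ [alpha al].
set e := quota_error p gamma N s in es *.
have eij j k : e j <= e k + 1.
  have := al j; have := al k; rewrite /is_rounding /e /quota_error.
  by move=> /andP[? ?] /andP[? ?]; lra.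
have m1 : 1 <= m%:R :> R by rewrite ler1n; apply: leq_ltn_trans (ltn_ord i).
have mE (x : R) : \sum_(j < m) x = m%:R * x.
  by rewrite sumr_const card_ord mulr_natl.
have le1 : \sum_(j < m) e i <= \sum_j (e j + 1) by apply: ler_sum.
have le2 : \sum_j (e j - 1) <= \sum_(j < m) e i.
  by apply: ler_sum => j _; rewrite lerBlDr.
rewrite [X in _ <= X]big_split /= es !mE in le1.
rewrite [X in X <= _]sumrB es !mE in le2.
have mg : `|gamma| <= m%:R * `|gamma| by rewrite ler_peMl.
have m0 : 0 < m%:R :> R by lra.
have g1 := ler_norm gamma; have g2 := ler_norm (- gamma); rewrite normrN in g2.
by rewrite ler_norml; apply/andP; split; rewrite -(ler_pM2l m0); lra.
Qed.

(* [s + n] competes with the optimal [s'] for house size [N + K]. *)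
Lemma quota_error_shift (N K : nat) (s s' n : 'I_m -> int)
    (e := quota_error p gamma N s) (e' := quota_error p gamma (N + K) s')
    (h := fun i => K%:R * p i - (n i)%:~R) :
  quota_outcome p gamma N s -> quota_outcome p gamma (N + K) s' ->
  \sum_i n i = K%:Z ->
  2 * \sum_i e i * h i <= \sum_i e i ^+ 2 - \sum_i e' i ^+ 2 + \sum_i h i ^+ 2.
Proof.
move=> [sN _] [sN' [alpha al]] nK.
have : \sum_i (1 - 2 * alpha) * (s i + n i - s' i)%:~R <=
       \sum_i ((e i - h i) ^+ 2 - e' i ^+ 2).
  apply: ler_sum => i _.
  apply: le_trans (rounding_optimal (s i + n i) (al i)) _.
  rewrite le_eqVlt; apply/orP; left; apply/eqP.
  rewrite /e /e' /h /quota_error intrD natrD; ring.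
(* Both [s + n] and [s'] have total [N + K], so the multiplier terms add up to zero. *)
rewrite -mulr_sumr -rmorph_sum /= sumrB big_split /= sN sN' nK.
rewrite PoszD subrr mulr0.
have -> : \sum_i ((e i - h i) ^+ 2 - e' i ^+ 2) =
  \sum_i e i ^+ 2 - \sum_i e' i ^+ 2 + \sum_i h i ^+ 2 - 2 * \sum_i e i * h i.
  rewrite mulr_sumr -!sumrB -big_split -sumrB /=.
  by apply: eq_bigr => i _; ring.
by rewrite subr_ge0.
Qed.

(** With the zero shift, each of the two outcomes competes with the other. *)
Lemma quota_error_sqr_unique (N : nat) (s s' : 'I_m -> int) :
  quota_outcome p gamma N s -> quota_outcome p gamma N s' ->
  \sum_i quota_error p gamma N s i ^+ 2 =
  \sum_i quota_error p gamma N s' i ^+ 2.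
Proof.
have le t t' : quota_outcome p gamma N t -> quota_outcome p gamma N t' ->
    \sum_i quota_error p gamma N t' i ^+ 2 <=
    \sum_i quota_error p gamma N t i ^+ 2.
  move=> qt; rewrite -[N in quota_outcome _ _ N t']addn0 => qt'.
  have := @quota_error_shift N 0 t t' (fun=> 0) qt qt'.
  rewrite big1// => /(_ erefl).
  rewrite [\sum_i _ * _]big1 => [|i _]; last by rewrite mul0r subrr mulr0.
  rewrite [\sum_i (0%:R * _ - _) ^+ 2]big1 => [|i _]; last first.
    by rewrite mul0r subrr expr0n.
  by rewrite mulr0 addr0 subr_ge0 addn0.
by move=> qs qs'; apply: le_anti; rewrite !le.
Qed.
End QuotaError.

(** * Limits of bounded vectors subject to the shift inequality *)

Section MeanVector.
Variables (R : realType) (m : nat) (p : 'I_m -> R) (gamma B : R).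
Variable a : nat -> 'I_m -> R.
Hypothesis p1 : \sum_i p i = 1.
Hypothesis pQ : rat_independent p.
Hypothesis aB : forall N i, `|a N i| <= B.
Hypothesis a_shift : forall (K : nat) (n : 'I_m -> int), \sum_i n i = K%:Z ->
  exists C : R, forall N, (0 < N)%N ->
    2 * \sum_i a N i * (K%:R * p i - (n i)%:~R) <=
    \sum_i (K%:R * p i - (n i)%:~R) ^+ 2 + C / N%:R.

(* The right-hand side of [a_shift] is quadratic in the shift, so a shift of
   size [t] in the direction [e_i - e_j] bounds the difference by [O(t)]. *)
Lemma mean_vector_balanced (i j : 'I_m) (eps : R) : 0 < eps ->
  \forall N \near \oo, a N i - a N j <= eps.
Proof.
move=> e0.
have B0 : 0 <= B by apply: le_trans (aB 0 i).
have [-> | ij] := eqVneq i j.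
  by apply: nearW => N; rewrite subrr ltW.
(* [D * t ^+ 2] covers the error of replacing [h] by [v] in the scalar product, taken twice, and the
   bound [4 * m * t ^+ 2] on the squared norm of [h]; the final 1 makes [D] positive. *)
pose D : R := 2 * (m%:R * B) + 4 * m%:R + 1.
have D0 : 0 < D by rewrite /D ltr_wpDl// addr_ge0 ?mulr_ge0.
pose t := Num.min 1 (eps / D).
have t0 : 0 < t by rewrite lt_min ltr01 divr_gt0.
have t1 : t <= 1 by rewrite ge_min lexx.
have tD : t * D <= eps by rewrite -ler_pdivlMr// ge_min lexx orbT.
have pick (F : 'I_m -> R) l : \sum_k F k * (k == l)%:R = F l.
  rewrite (bigD1 l)//= eqxx mulr1 big1 ?addr0// => k /negPf ->.
  by rewrite mulr0.
have vE (F : 'I_m -> R) : \sum_k F k * (t * ((k == i)%:R - (k == j)%:R)) =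
    t * (F i - F j).
  rewrite -(pick F i) -(pick F j) -sumrB mulr_sumr.
  by apply: eq_bigr => k _; ring.
pose v k : R := t * ((k == i)%:R - (k == j)%:R).
have v0 : \sum_k v k = 0.
  apply: etrans (_ : _ = t * (1 - 1)) _; last by rewrite subrr mulr0.
  by rewrite -(vE (fun=> 1)); apply: eq_bigr => k _; rewrite mul1r.
have tt0 : 0 < t ^+ 2 by rewrite exprn_gt0.
(* Precision [t ^+ 2], and not [t], keeps the approximation error of lower order than the main term
   [t * (a N i - a N j)]. *)
have [K [n [nK nv]]] := simultaneous_density p1 pQ v0 tt0.
have [C Cn] := a_shift nK.
set h := fun k => K%:R * p k - (n k)%:~R in Cn.
have hv k : `|h k - v k| <= t ^+ 2 by apply: ltW; exact: nv.
have vt k : `|v k| <= t.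
  rewrite /v normrM (ger0_norm (ltW t0)) -[X in _ <= X]mulr1 ler_pM2l//.
  case: (_ == _); case: (_ == _);
    by rewrite /= ?subrr ?subr0 ?sub0r ?normrN ?normr0 ?normr1.
have tt : t ^+ 2 <= t by rewrite expr2 ler_piMl// ltW.
have hsq : \sum_k h k ^+ 2 <= m%:R * (4 * t ^+ 2).
  have mE (x : R) : \sum_(k < m) x = m%:R * x.
    by rewrite sumr_const card_ord mulr_natl.
  rewrite -mE; apply: ler_sum => k _.
  have hk : `|h k| <= 2 * t.
    rewrite -[h k](subrK (v k)); apply: le_trans (ler_normD _ _) _.
    by have := hv k; have := vt k; lra.
  rewrite -(@ger0_norm _ (h k ^+ 2)) ?sqr_ge0// normrX.
  have -> : 4 * t ^+ 2 = (2 * t) ^+ 2 by ring.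
  by apply: lerXn2r; rewrite // nnegrE mulr_ge0// ltW.
have av N : t * (a N i - a N j) - m%:R * (B * t ^+ 2) <= \sum_k a N k * h k.
  rewrite -(vE (a N)).
  rewrite lerBlDr -lerBlDl -sumrB.
  apply: le_trans (_ : \sum_(k < m) B * t ^+ 2 <= _); last first.
    by rewrite sumr_const card_ord mulr_natl.
  apply: ler_sum => k _; rewrite -mulrBr.
  apply: le_trans (ler_norm _) _; rewrite normrM distrC.
  exact: ler_pM.
exists (Num.truncn (C / (t * eps))).+1 => // N /= CN.
have N0 : (0 < N)%N by apply: leq_trans CN.
have CN' : C / N%:R <= t * eps.
  rewrite ler_pdivrMr ?ltr0n// mulrC -ler_pdivrMr ?mulr_gt0//.
  by apply/ltW/(lt_le_trans (truncnS_gt _)); rewrite ler_nat.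
have := Cn N N0; have := av N => avN CnN.
have tDt : t * (t * D) <= t * eps by rewrite ler_pM2l.
rewrite -(ler_pM2l t0).
have : 2 * (t * (a N i - a N j)) <= 2 * (t * eps).
  have -> : 2 * (t * eps) = t * eps + t * eps by ring.
  apply: le_trans (lerD tDt (lexx _)).
  rewrite /D; lra.
lra.
Qed.

Hypothesis a_sum : \sum_i a N i @[N --> \oo] --> - gamma.

(** Summing [a N i - a N j] over [j] compares [m * a N i] with the total, which tends to
    [- gamma]. *)
Lemma mean_vector_cvg (i : 'I_m) : a N i @[N --> \oo] --> - gamma / m%:R.
Proof.
apply/cvgrPdist_le => eps e0.
have e2 : 0 < eps / 2 by rewrite divr_gt0.
have m0 : 0 < m%:R :> R by rewrite ltr0n; apply: leq_ltn_trans (ltn_ord i).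
have m1 : 1 <= m%:R :> R by rewrite ler1n; apply: leq_ltn_trans (ltn_ord i).
have mE (x : R) : \sum_(k < m) x = m%:R * x.
  by rewrite sumr_const card_ord mulr_natl.
have up : \forall N \near \oo, forall j, a N i - a N j <= eps / 2.
  by apply: filter_forall => j; exact: mean_vector_balanced.
have lo : \forall N \near \oo, forall j, a N j - a N i <= eps / 2.
  by apply: filter_forall => j; exact: mean_vector_balanced.
have /cvgrPdist_le/(_ _ e2) sm := a_sum.
near=> N.
have u : forall j, a N i - a N j <= eps / 2 by near: N.
have l : forall j, a N j - a N i <= eps / 2 by near: N.
have : `|- gamma - \sum_k a N k| <= eps / 2 by near: N.
have su : \sum_(j < m) (a N i - a N j) <= \sum_(j < m) (eps / 2).
  by apply: ler_sum => j _; exact: u.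
have sl : \sum_(j < m) (a N j - a N i) <= \sum_(j < m) (eps / 2).
  by apply: ler_sum => j _; exact: l.
rewrite !sumrB !mE in su sl.
have me : eps / 2 <= m%:R * (eps / 2) by rewrite ler_peMl// ltW.
rewrite !ler_norml => /andP[s1 s2]; apply/andP.
split; rewrite -(ler_pM2l m0) mulrBr mulrCA divff ?gt_eqF// mulr1; lra.
Unshelve. all: by end_near. Qed.
End MeanVector.

(** * Expectations at a random house size *)

Lemma integrableB_cst d (T : measurableType d) (R : realType)
    (P : probability T R) (f : T -> R) (c : R) :
  P.-integrable setT (EFin \o f) ->
  P.-integrable setT (EFin \o (fun w => f w - c)).
Proof.
move=> fi; have ci := finite_measure_integrable_cst P c measurableT.
exact: (eq_integrable measurableT _ _ _ (integrableB measurableT fi ci)).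
Qed.

Lemma Rintegral_sum d (T : measurableType d) (R : realType)
    (mu : {finite_measure set T -> \bar R}) (I : Type) (r : seq I) (D : set T)
    (f : I -> T -> R) (c : I -> R) :
  measurable D -> (forall i, mu.-integrable D (EFin \o f i)) ->
  mu.-integrable D (EFin \o (fun w => \sum_(i <- r) f i w * c i)) /\
  \int[mu]_(w in D) (\sum_(i <- r) f i w * c i) =
  \sum_(i <- r) (\int[mu]_(w in D) f i w) * c i.
Proof.
move=> mD fi; elim: r => [|i r [ri rE]].
  rewrite big_nil; split.
    apply: (eq_integrable mD _ _ _ (integrable0 mu D)) => w _ /=.
    by rewrite big_nil.
  under eq_Rintegral do rewrite big_nil.
  by rewrite Rintegral_cst// mul0r.
have fci : mu.-integrable D (EFin \o (fun w => f i w * c i)).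
  exact: (eq_integrable mD _ _ _ (integrableZr mD (c i) (fi i))).
split.
  apply: (eq_integrable mD _ _ _ (integrableD mD fci ri)) => w _ /=.
  by rewrite big_cons.
under eq_Rintegral do rewrite big_cons.
by rewrite RintegralD// rE big_cons RintegralZr.
Qed.

Lemma fine_uniform_upto d (T : measurableType d) (R : realType)
    (P : probability T R) (N0 : nat) (X : {RV P >-> nat}) (k : nat) :
  uniform_upto N0 X -> (0 < k)%N -> (k < N0.+1)%N ->
  fine (P (X @^-1` [set k])) = N0%:R^-1.
Proof. by move=> Xu k0 kN; rewrite Xu ?k0. Qed.

(** The fibers of [X] over [1, ..., N0] are disjoint and have total mass 1, so their complement is
    null and the expectation splits along them. *)
Lemma expectation_random_index d (T : measurableType d) (R : realType)
    (P : probability T R) (N0 : nat) (X : {RV P >-> nat}) (f : nat -> T -> R) :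
  (0 < N0)%N -> uniform_upto N0 X ->
  (forall k, P.-integrable setT (EFin \o f k)) ->
  'E_P[fun w => f (X w) w]%E =
  (\sum_(1 <= k < N0.+1) \int[P]_(w in X @^-1` [set k]) f k w)%:E.
Proof.
move=> N00 Xu fi.
pose F k : set T := X @^-1` [set k].
have mF k : measurable (F k) by exact: measurable_funPTI.
have tF1 : trivIset setT (fun k => F k.+1).
  by move=> k l _ _ [w [kw lw]]; apply: succn_inj; rewrite -kw -lw.
have mf k : measurable_fun setT (f k).
  by apply/measurable_EFinP; exact: measurable_int (fi k).
have mfX : measurable_fun setT (fun w => f (X w) w).
  (* Measurability is checked on the countably many fibers, on each of which the function is a fixed
     [f k]. *)
  have -> : setT = \bigcup_k F k by apply/seteqP; split=> // w _; exists (X w).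
  apply/measurable_fun_bigcup => // k.
  apply: (eq_measurable_fun (f k)); first by move=> w /set_mem <-.
  exact: measurable_funTS.
pose D := \big[setU/set0]_(k < N0) F k.+1.
have mD : measurable D by exact: bigsetU_measurable.
have PD : P D = 1%E.
  rewrite /D (measure_bigsetU P (fun k => mF k.+1) tF1).
  rewrite (eq_bigr (fun=> (N0%:R^-1)%:E)) => [|k _]; last first.
    by apply: Xu; rewrite ltn_ord.
  rewrite sumEFin sumr_const card_ord -[X in X%:E]mulr_natr mulVf//.
  by rewrite pnatr_eq0 -lt0n.
have mEf (A : set T) : measurable_fun A (EFin \o (fun w => f (X w) w)).
  by apply: measurable_funTS; exact/measurable_EFinP.
rewrite unlock -(setvU D) integral_setU//; last 2 first.
- exact: measurableC.
- by rewrite disj_set2E setICl.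
have PDC : P (~` D) = 0%E by rewrite probability_setC// PD subee.
rewrite (null_set_integral (measurableC mD) (mEf _) PDC) add0e.
have -> : D = \big[setU/set0]_(k <- index_iota 0 N0) F k.+1.
  by rewrite big_mkord.
rewrite (integral_bigsetU_EFin P (fun k => mF k.+1) (iota_uniq _ _)
  (sub_trivIset (@subsetT _ _) tF1) (mEf _)).
rewrite big_add1 -sumEFin; apply: eq_bigr => k _.
rewrite fineK; last first.
  apply: integrable_fin_num; first exact: mF.
  exact: (integrableS measurableT (mF k.+1) (@subsetT _ _) (fi k.+1)).
by apply: eq_integral => w /set_mem ->.
Qed.

(** Absolute continuity of the integral, as the fiber has mass [1 / N0]. This disposes of each fixed
    house size, including those with [N + gamma <= 0]. *)
Lemma Rintegral_fiber_cvg0 d (T : measurableType d) (R : realType)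
    (P : probability T R) (X : nat -> {RV P >-> nat}) (f : T -> R) (k : nat) :
  (0 < k)%N -> (forall N0, (0 < N0)%N -> uniform_upto N0 (X N0)) ->
  P.-integrable setT (EFin \o f) ->
  \int[P]_(w in X N0 @^-1` [set k]) f w @[N0 --> \oo] --> 0.
Proof.
move=> k0 Xu fi; apply/cvgr0Pnorm_lt => e e0.
have [r [r0 re]] := integral_normr_continuous fi e0.
exists (maxn k (Num.truncn r^-1).+1) => // N0 /=.
rewrite geq_max => /andP[kN rN].
have mF : measurable (X N0 @^-1` [set k]) by exact: measurable_funPTI.
apply: le_lt_trans (le_normr_Rintegral mF _) _.
  exact: integrableS measurableT mF (@subsetT _ _) fi.
have N00 : (0 < N0)%N by apply: leq_trans kN.
apply: re => //; have : ((N0%:R^-1)%:E < r%:E)%E.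
  rewrite lte_fin invf_plt ?posrE ?ltr0n//.
  by apply: lt_le_trans (truncnS_gt _) _; rewrite ler_nat.
by rewrite -(Xu N0 N00 k) ?k0.
Qed.

(** Each unit of shift telescopes to a boundary term [V (a + K) - V (b + K)], at most [C] whatever
    the length of the range. *)
Lemma sum_shift_le (R : realType) (V : nat -> R) (C : R) (a b K : nat) :
  (forall k, (a <= k)%N -> 0 <= V k <= C) -> (a <= b)%N ->
  \sum_(a <= k < b) (V k - V (k + K)%N) <= K%:R * C.
Proof.
move=> VC ab; elim: K => [|K IH].
  by under eq_bigr do rewrite addn0 subrr; rewrite big1// mul0r.
have -> : \sum_(a <= k < b) (V k - V (k + K.+1)%N) =
  \sum_(a <= k < b) (V k - V (k + K)%N) -
  \sum_(a <= k < b) (V (k.+1 + K)%N - V (k + K)%N).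
  by rewrite -sumrB; apply: eq_bigr => k _; rewrite addSnnS; ring.
rewrite (telescope_sumr (fun k => V (k + K)%N))//.
have /andP[_ +] := VC _ (leq_addr K a).
have /andP[+ _] := VC _ (leq_trans ab (leq_addr K b)).
rewrite -natr1 mulrDl mul1r; lra.
Qed.

Lemma fraction_above_cvg (R : realType) (a : nat) :
  (N.+1 - a)%N%:R / N%:R @[N --> \oo] --> (1 : R).
Proof.
apply/cvgrPdist_le => e e0.
exists (maxn a (Num.truncn (a.+1%:R / e)).+1) => // N /=.
rewrite geq_max => /andP[aN eN].
have N0 : 0 < N%:R :> R by rewrite ltr0n; apply: leq_trans eN.
have eN' : a.+1%:R <= e * N%:R.
  rewrite mulrC -ler_pdivrMr//; apply/ltW/(lt_le_trans (truncnS_gt _)).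
  by rewrite ler_nat.
have a0 : 0 <= a%:R :> R by [].
have eN0 : 0 <= e * N%:R by rewrite mulr_ge0// ltW.
rewrite natrB ?leqW// -natr1; rewrite -natr1 in eN'.
have up : (N%:R + 1 - a%:R) / N%:R <= 1 + e by rewrite ler_pdivrMr//; lra.
have lo : 1 - e <= (N%:R + 1 - a%:R) / N%:R by rewrite ler_pdivlMr//; lra.
by rewrite ler_norml; apply/andP; split; lra.
Qed.

(** * Mean error of the quota method over the house sizes *)

Section QuotaMean.
Context (R : realType) (m : nat) (p : 'I_m -> R) (gamma : R)
  d (T : measurableType d) (P : probability T R)
  (S : nat -> 'I_m -> T -> int) (X : nat -> {RV P >-> nat}).
Hypothesis p1 : \sum_i p i = 1.
Hypothesis hS : random_quota_method p gamma P S.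
Hypothesis hX : forall N0 : nat, (0 < N0)%N -> uniform_upto N0 (X N0).

Let err N i w := quota_error p gamma N (fun j => S N j w) i.
Let fiber N0 k : set T := X N0 @^-1` [set k].
Let share N0 k i := \int[P]_(w in fiber N0 k) err k i w.

(* Each fiber has mass [1 / N0], so this is already an average over [N]. *)
Definition mean_quota_error (N1 N0 : nat) (i : 'I_m) : R :=
  \sum_(N1 <= k < N0.+1) share N0 k i.

Let fiber_meas N0 k : measurable (fiber N0 k).
Proof. exact: measurable_funPTI. Qed.

Let fiber_prob N0 k : (0 < k)%N -> (k < N0.+1)%N ->
  fine (P (fiber N0 k)) = N0%:R^-1.
Proof.
move=> k0 kN; apply: fine_uniform_upto => //; apply: hX.
exact: leq_trans k0 kN.
Qed.

Let err_int N i : P.-integrable setT (EFin \o err N i).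
Proof. by apply: integrableB_cst; have [+ _] := hS; apply. Qed.

Let err_int_fiber N0 k i : P.-integrable (fiber N0 k) (EFin \o err k i).
Proof.
exact: (integrableS measurableT (fiber_meas _ _) (@subsetT _ _) (err_int _ _)).
Qed.

Section Above.
Variable N1 : nat.
Hypothesis N1_gt0 : (0 < N1)%N.
Hypothesis N1_good : 0 < N1%:R + gamma.

Let good k w : (N1 <= k)%N -> quota_outcome p gamma k (fun i => S k i w).
Proof.
move=> N1k; have [_] := hS; apply; first exact: leq_trans N1k.
by apply: lt_le_trans N1_good _; rewrite lerD2r ler_nat.
Qed.

Let cst_int N0 k (c : R) : P.-integrable (fiber N0 k) (EFin \o cst c).
Proof. exact: finite_measure_integrable_cst. Qed.

Let share_lincomb N0 k (h : 'I_m -> R) (c : R) :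
  (N1 <= k)%N -> (k < N0.+1)%N ->
  (forall w, \sum_i err k i w * h i <= c) ->
  \sum_i share N0 k i * h i <= c / N0%:R.
Proof.
move=> N1k kN hc; have k0 := leq_trans N1_gt0 N1k.
have [li <-] := Rintegral_sum (index_enum 'I_m) h (fiber_meas N0 k)
  (err_int_fiber N0 k).
rewrite -(fiber_prob k0 kN) -Rintegral_cst//.
apply: le_Rintegral => //; exact: cst_int.
Qed.

Let share_bound N0 k i : (N1 <= k)%N -> (k < N0.+1)%N ->
  `|share N0 k i| <= (1 + `|gamma|) / N0%:R.
Proof.
move=> N1k kN; have k0 := leq_trans N1_gt0 N1k.
apply: le_trans (le_normr_Rintegral (fiber_meas _ _) (err_int_fiber _ _ _)) _.
rewrite -(fiber_prob k0 kN) -Rintegral_cst//.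
apply: le_Rintegral => // [||w _]; [exact: integrable_norm|exact: cst_int|].
exact/quota_error_bound/good.
Qed.

Let share_sum N0 k : (N1 <= k)%N -> (k < N0.+1)%N ->
  \sum_i share N0 k i = - gamma / N0%:R.
Proof.
move=> N1k kN; have k0 := leq_trans N1_gt0 N1k.
have [_] := Rintegral_sum (index_enum 'I_m) (fun=> 1) (fiber_meas N0 k)
  (err_int_fiber N0 k).
under [RHS]eq_bigr do rewrite mulr1; move=> <-.
rewrite -(fiber_prob k0 kN) -Rintegral_cst//; apply: eq_Rintegral => w _.
by under eq_bigr do rewrite mulr1; apply: quota_error_sum => //; exact: good.
Qed.

Lemma mean_quota_error_bound N0 i :
  `|mean_quota_error N1 N0 i| <= 1 + `|gamma|.
Proof.
have g0 : 0 <= 1 + `|gamma| by rewrite addr_ge0.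
apply: le_trans (ler_norm_sum _ _ _) _.
apply: le_trans (_ : \sum_(N1 <= k < N0.+1) (1 + `|gamma|) / N0%:R <= _).
  rewrite big_nat [X in _ <= X]big_nat; apply: ler_sum => k /andP[? ?].
  exact: share_bound.
rewrite sumr_const_nat -[X in X <= _]mulr_natr -mulrA ler_piMr//.
case: N0 => [|N0]; first by rewrite invr0 mul0r.
rewrite mulrC ler_pdivrMr// mul1r ler_nat.
by rewrite leq_subLR -add1n leq_add2r.
Qed.

Lemma mean_quota_error_sum N0 :
  \sum_i mean_quota_error N1 N0 i = - gamma * ((N0.+1 - N1)%N%:R / N0%:R).
Proof.
rewrite exchange_big /= big_nat (eq_bigr (fun=> - gamma / N0%:R)).
  by rewrite -big_nat sumr_const_nat -[LHS]mulr_natr mulrAC mulrA.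
by move=> k /andP[? ?]; exact: share_sum.
Qed.

(** The competition inequality is integrated over each fiber; the squared norms are constant there,
    so their sum over the house sizes telescopes up to [K * C]. *)
Lemma mean_quota_error_shift (K : nat) (n : 'I_m -> int)
    (h := fun i => K%:R * p i - (n i)%:~R) :
  \sum_i n i = K%:Z -> exists C : R, forall N0, (0 < N0)%N ->
    2 * \sum_i mean_quota_error N1 N0 i * h i <= \sum_i h i ^+ 2 + C / N0%:R.
Proof.
move=> nK.
(* The squared error does not depend on how ties are resolved. *)
pose V k := \sum_i err k i point ^+ 2.
pose C := m%:R * (1 + `|gamma|) ^+ 2.
have VC k : (N1 <= k)%N -> 0 <= V k <= C.
  move=> N1k; rewrite sumr_ge0 => [/=|i _]; last exact: sqr_ge0.
  have -> : C = \sum_(i < m) (1 + `|gamma|) ^+ 2.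
    by rewrite /C sumr_const card_ord mulr_natl.
  apply: ler_sum => i _; rewrite -(@ger0_norm _ (_ ^+ 2)) ?sqr_ge0// normrX.
  by apply: lerXn2r; rewrite ?nnegrE ?addr_ge0//; exact/quota_error_bound/good.
set H := \sum_i h i ^+ 2.
have H0 : 0 <= H by apply: sumr_ge0 => i _; exact: sqr_ge0.
exists (K%:R * C) => N0 N00.
have N0R : 0 < N0%:R :> R by rewrite ltr0n.
have hk k : (N1 <= k)%N -> (k < N0.+1)%N ->
    \sum_i share N0 k i * h i <= ((V k - V (k + K)%N + H) / 2) / N0%:R.
  move=> N1k kN; apply: share_lincomb => // w.
  rewrite ler_pdivlMr// mulrC /V.
  (* The outcome at [w] for size [k] may compete with the outcome at [point] for size [k + K], since
     only the squared norm of the latter enters. *)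
  rewrite (quota_error_sqr_unique (good point N1k) (good w N1k)).
  have N1kK := leq_trans N1k (leq_addr K k).
  exact: (quota_error_shift (good w N1k) (good point N1kK) nK).
have -> : \sum_i mean_quota_error N1 N0 i * h i =
    \sum_(N1 <= k < N0.+1) \sum_i share N0 k i * h i.
  by rewrite exchange_big /=; apply: eq_bigr => i _; rewrite mulr_suml.
apply: le_trans (_ : 2 * \sum_(N1 <= k < N0.+1)
    ((V k - V (k + K)%N + H) / 2) / N0%:R <= _).
  rewrite ler_pM2l// big_nat [X in _ <= X]big_nat.
  apply: ler_sum => k /andP[? ?]; exact: hk.
rewrite -!mulr_suml mulrA [2 * _]mulrC divfK// ler_pdivrMr// mulrDl.
rewrite divfK ?gt_eqF// big_split /= addrC.
have [N1N|NN1] := leqP N1 N0.+1; last first.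
  by rewrite !(big_geq (ltnW NN1)) add0r addr_ge0// mulr_ge0// mulr_ge0.
apply: lerD; last exact: sum_shift_le.
rewrite sumr_const_nat -[X in X <= _]mulr_natr ler_wpM2l// ler_nat.
by rewrite leq_subLR -add1n leq_add2r.
Qed.

End Above.
End QuotaMean.

(** * The limit of the expected seat excess *)

Unset Implicit Arguments.

Theorem theorem3p11 (R : realType) (m : nat) (p : 'I_m -> R) (gamma : R)
    (d : measure_display) (T : measurableType d) (P : probability T R)
    (S : nat -> 'I_m -> T -> int) (X : nat -> {RV P >-> nat})
    (hm : (2 <= m)%N)
    (hp : forall i, 0 < p i)
    (hp1 : \sum_i p i = 1)
    (hpQ : rat_independent p)
    (hS : random_quota_method p gamma P S)
    (hX : forall N0 : nat, (0 < N0)%N -> uniform_upto N0 (X N0)) :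
  forall i : 'I_m,
    'E_P[fun w => seat_excess p (X N0 w) (fun j => S (X N0 w) j w) i]%E
      @[N0 --> \oo] --> (gamma * (p i - m%:R^-1))%:E.
Proof.
move=> i.
(* From [N1] on, [N + gamma] is positive and the method is defined. *)
pose N1 := (Num.truncn `|gamma|).+1.
have N1g : 0 < N1%:R + gamma.
  have := truncnS_gt `|gamma|; have := ler_norm (- gamma).
  by rewrite normrN /N1; lra.
pose f k w := seat_excess p k (fun j => S k j w) i.
have fi k : P.-integrable setT (EFin \o f k).
  by apply: integrableB_cst; have [+ _] := hS; apply.
pose I N0 k := \int[P]_(w in X N0 @^-1` [set k]) f k w.
pose a N0 := mean_quota_error p gamma S X N1 N0 i.
(* Three contributions: the finitely many sizes below [N1], the mean error, and the constant
   [gamma * p i] weighted by the proportion of sizes from [N1] on. Their limits are 0, [- gamma / m]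
   and [gamma * p i]. *)
have Ef : \forall N0 \near \oo, (\sum_(1 <= k < N1) I N0 k + a N0 +
      gamma * p i * ((N0.+1 - N1)%N%:R / N0%:R))%:E =
    'E_P[fun w => seat_excess p (X N0 w) (fun j => S (X N0 w) j w) i]%E.
  exists N1 => // N0 /= N1N0.
  have N00 : (0 < N0)%N by apply: leq_trans N1N0.
  rewrite (expectation_random_index N00 (hX _ N00) fi); congr (_%:E).
  rewrite [RHS](@big_cat_nat _ _ _ N1)/=; [|by []|exact: leqW].
  rewrite -addrA; congr (_ + _).
  rewrite /a /mean_quota_error.
  have -> : gamma * p i * ((N0.+1 - N1)%N%:R / N0%:R) =
      \sum_(N1 <= k < N0.+1) gamma * p i / N0%:R.
    by rewrite sumr_const_nat -[RHS]mulr_natr mulrA mulrAC.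
  rewrite -big_split /= big_nat [RHS]big_nat; apply: eq_bigr => k /andP[N1k kN].
  have mF : measurable (X N0 @^-1` [set k]) by exact: measurable_funPTI.
  have k0 : (0 < k)%N by exact: leq_trans N1k.
  have -> : gamma * p i / N0%:R =
      \int[P]_(w in X N0 @^-1` [set k]) (gamma * p i).
    by rewrite -(fine_uniform_upto (hX _ N00) k0 kN) -Rintegral_cst.
  rewrite -RintegralD//.
  - by apply: eq_Rintegral => w _; rewrite /f /quota_error /seat_excess; ring.
  - apply: (integrableS measurableT mF (@subsetT _ _)).
    by apply: integrableB_cst; have [+ _] := hS; apply.
  - exact: finite_measure_integrable_cst.
apply: cvg_trans (near_eq_cvg Ef) _.
apply: cvg_EFin; first exact: nearW.
have small : \sum_(1 <= k < N1) I N0 k @[N0 --> \oo] --> (0 : R).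
  rewrite [X in _ --> X](_ : 0 = \sum_(1 <= k < N1) (0 : R)); last first.
    by rewrite big1.
  rewrite big_nat; under eq_cvg do rewrite big_nat.
  apply: cvg_big => [|k /andP[k0 _]]; first exact: add_continuous.
  exact: Rintegral_fiber_cvg0.
have ratio := @fraction_above_cvg R N1.
have large : a N0 @[N0 --> \oo] --> - gamma / m%:R.
  apply: (mean_vector_cvg hp1 hpQ).
  - exact: (mean_quota_error_bound hp1 hS hX (ltn0Sn _) N1g).
  - exact: (mean_quota_error_shift hp1 hS hX (ltn0Sn _) N1g).
  under eq_cvg do rewrite (mean_quota_error_sum hp1 hS hX (ltn0Sn _) N1g).
  rewrite -(mulr1 (- gamma)); apply: cvgM => //.
  by rewrite mulr1; exact: cvg_cst.
have -> : gamma * (p i - m%:R^-1) = 0 + - gamma / m%:R + gamma * p i * 1.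
  by ring.
by apply: cvgD; [exact: cvgD|apply: cvgM => //; exact: cvg_cst].
Qed.
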